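(* Let $d\in\mathbb{R}$, and consider the complex system $$\frac{dz}{dT}=z+\sum_{k+j+l\ge 2}a_{kjl}z^kw^ju^l=Z(z,w,u),\qquad \frac{dw}{dT}=-w-\sum_{k+j+l\ge 2}b_{kjl}w^kz^ju^l=-W(z,w,u),$$ $$\frac{du}{dT}=\mathbf{i}\,d\,u+\sum_{k+j+l\ge 2}d_{kjl}z^kw^ju^l=U(z,w,u),$$ with $a_{kjl},b_{kjl},d_{kjl}\in\mathbb{C}$ ($k,j,l$ nonnegative integers). When taking $e_{100}=1$, $e_{001}=e_{010}=0$, and $e_{k+1,k,0}=0$ for $k=1,2,\dots$, one can derive successively and uniquely the terms of a formal series $$g(w,z,u)=w+\sum_{\alpha+\beta+\gamma=2}^{\infty}e_{\alpha\beta\gamma}w^{\alpha}z^{\beta}u^{\gamma}$$ such that $$\frac{dg}{dT}+g=\frac{\partial g}{\partial z}Z-\frac{\partial g}{\partial w}W+\frac{\partial g}{\partial u}U+g=-w\cdot\sum_{m=1}^{\infty}q'_m(zw)^m ,$$ and, for $\alpha+\beta+\gamma\ge 2$, if $\alpha\neq\beta+1$, or $\alpha=\beta+1$ and $\gamma\neq 0$, then $e_{\alpha\beta\gamma}$ is determined by the recursive formula $$e_{\alpha\beta\gamma}=\frac{1}{1+\beta-\alpha-\mathbf{i}d\gamma}\sum_{k+j+l=3}^{\alpha+\beta+\gamma+2}\big[(\alpha-k+1)b_{k,j-1,l}-(\beta-j+1)a_{j,k-1,l}-(\gamma-l)d_{j-1,k-1,l+1}\big]\,e_{\alpha-k+1,\beta-j+1,\gamma-l},$$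 and for every positive integer $m$, $q'_m$ is determined by the recursive formula $$q'_m=\sum_{k+j+l=3}^{2m+3}\big[(m-k+2)b_{k,j-1,l}-(m-j+1)a_{j,k-1,l}-l\,d_{j-1,k-1,l+1}\big]\,e_{m-k+2,m-j+1,-l}.$$
   Context: $\mathbf{i}=\sqrt{-1}$. All series are treated as formal power series. Conventions for the formulas: $e_{\alpha\beta\gamma}=0$ whenever $\alpha<0$ or $\beta<0$ or $\gamma<0$, or when $\gamma=0$ and $\alpha=\beta+1$ with $(\alpha,\beta,\gamma)\ne(1,0,0)$, while $e_{100}=1$; also $e_{000}=0$ since $g$ has no constant term. The sum $\sum_{k+j+l=3}^{N}$ runs over all integers $k,j\ge 0$, $l\ge -1$ with $3\le k+j+l\le N$, and any coefficient $a$, $b$ or $d$ having a negative index is taken to be $0$. (The system above arises from a real system $\dot x=-y+\cdots$, $\dot y=x+\cdots$, $\dot u=-du+\cdots$ by $z=x+\mathbf{i}y$, $w=x-\mathbf{i}y$, $t=-T\mathbf{i}$.)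
   Formalization: As printed the claim fails; proved instead with denominator 1+β−α+𝐢dγ (not −𝐢dγ), with +l·d_{j-1,k-1,l+1} (not −l·d) in the formula for q'_m, and for d≠0 only, since at d=0 the denominator vanishes when α=β+1, γ≠0. *)

(* Defs.v *)
From HB Require Import structures.
From mathcomp Require Import all_boot all_order all_algebra.
From mathcomp Require Import reals.
From mathcomp Require Export complex.

Set Implicit Arguments.
Unset Strict Implicit.
Unset Printing Implicit Defensive.

Import Order.TTheory GRing.Theory Num.Theory.
Local Open Scope ring_scope.

Section FormalPowerSeries.
Variable K : nzRingType.

(* A formal power series in (w, z, u) is the family of its coefficients:
   F al be ga is the coefficient of w^al z^be u^ga. *)
Definition fps3 := nat -> nat -> nat -> K.

Implicit Types F G : fps3.

Definition fadd F G : fps3 := fun al be ga => F al be ga + G al be ga.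
Definition fopp F : fps3 := fun al be ga => - F al be ga.
Definition fscale (c : K) F : fps3 := fun al be ga => c * F al be ga.

Definition fmul F G : fps3 := fun al be ga =>
  \sum_(i < al.+1) \sum_(j < be.+1) \sum_(k < ga.+1)
    F i j k * G (al - i)%N (be - j)%N (ga - k)%N.

Definition fmon (i j k : nat) : fps3 := fun al be ga =>
  ((al == i) && (be == j) && (ga == k))%:R.

Definition fw := fmon 1 0 0.
Definition fz := fmon 0 1 0.
Definition fu := fmon 0 0 1.

Definition dw F : fps3 := fun al be ga => al.+1%:R * F al.+1 be ga.
Definition dz F : fps3 := fun al be ga => be.+1%:R * F al be.+1 ga.
Definition du F : fps3 := fun al be ga => ga.+1%:R * F al be ga.+1.

(* The terms of total degree at least 2. *)
Definition ftail2 F : fps3 := fun al be ga =>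
  if (2 <= al + be + ga)%N then F al be ga else 0.

(* \sum_(m >= 1) q_m (z w)^m *)
Definition fdiag (q : nat -> K) : fps3 := fun al be ga =>
  if [&& (0 < al)%N, al == be & ga == 0%N] then q al else 0.

(* Coefficient families are extended by 0 to negative indices. *)
Definition ext (f : nat -> nat -> nat -> K) (x y t : int) : K :=
  match x, y, t with
  | Posz i, Posz j, Posz k => f i j k
  | _, _, _ => 0
  end.

(* \sum F k j l over all integers k, j >= 0, l >= -1 with 3 <= k + j + l <= N.
   The index p stands for l + 1; the constraint forces k, j, p <= N + 1. *)
Definition sum3 (N : nat) (F : int -> int -> int -> K) : K :=
  \sum_(k < N.+2) \sum_(j < N.+2)
    \sum_(p < N.+2 | (3 <= k%:Z + j%:Z + (p%:Z - 1) <= N%:Z))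
      F k%:Z j%:Z (p%:Z - 1).

End FormalPowerSeries.

Section System.
Variable R : realType.
Local Notation C := (R[i]).
Variables (d : R) (a b c : nat -> nat -> nat -> C).

(* a k j l multiplies z^k w^j u^l, whereas b k j l multiplies w^k z^j u^l;
   c is the family of coefficients d_{kjl} of z^k w^j u^l in du/dT. *)
Definition Zs : fps3 C := fadd (@fz C) (ftail2 (fun al be ga => a be al ga)).
Definition Ws : fps3 C := fadd (@fw C) (ftail2 (fun al be ga => b al be ga)).
Definition Us : fps3 C :=
  fadd (fscale (Complex 0 1 * Complex d 0) (@fu C))
       (ftail2 (fun al be ga => c be al ga)).

(* dg/dT along dz/dT = Z, dw/dT = - W, du/dT = U.  Since du/dT = + i d u + ...,
   the linear part of g |-> dg/dT + g multiplies w^al z^be u^ga by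
   1 + be - al + i d ga; for d = 0 this vanishes at al = be + 1, ga > 0, and
   then g need not exist nor be unique. *)
Definition ddT (g : fps3 C) : fps3 C :=
  fadd (fadd (fmul (dz g) Zs) (fopp (fmul (dw g) Ws))) (fmul (du g) Us).

Definition gser (e : nat -> nat -> nat -> C) : fps3 C :=
  fadd (@fw C) (ftail2 e).

(* e 0 0 0 = 0 because g has no constant term. *)
Definition normalized (e : nat -> nat -> nat -> C) : Prop :=
  [/\ e 0%N 0%N 0%N = 0, e 1%N 0%N 0%N = 1, e 0%N 0%N 1%N = 0,
      e 0%N 1%N 0%N = 0 & forall k, (0 < k)%N -> e k.+1 k 0%N = 0].

(* dg/dT + g = - w * \sum_(m >= 1) q_m (z w)^m, coefficient by coefficient. *)
Definition solves (e : nat -> nat -> nat -> C) (q : nat -> C) : Prop :=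
  forall al be ga : nat,
    fadd (ddT (gser e)) (gser e) al be ga
    = fopp (fmul (@fw C) (fdiag q)) al be ga.

End System.

(* Main.v *)
(* Comparing coefficients of w^al z^be u^ga, the equation reads
     lam al be ga * e al be ga = source e al be ga - (q be if (al, be, ga) = (be + 1, be, 0)),
   where [lam] is the eigenvalue of the linear part and [source e al be ga], the
   sum of the recursive formula, only involves coefficients of e of total degree
   less than al + be + ga.  For d != 0, [lam] vanishes exactly at the resonant
   indices (be + 1, be, 0), where e is prescribed and the equation gives q be.
   So the normalized solutions e are the fixed points of an operator whose value
   in each degree depends on lower degrees only; there is exactly one. *)
Require Import Defs.
From mathcomp Require Import all_boot all_order all_algebra.
From mathcomp Require Import boolp reals complex.
From mathcomp Require Import zify ring.

Set Implicit Arguments.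
Unset Strict Implicit.
Unset Printing Implicit Defensive.

Import Order.TTheory GRing.Theory Num.Theory.
Local Open Scope ring_scope.

Lemma sum_ord_shift (V : nmodType) (n s m : nat) (f : nat -> V) :
  (s + m <= n)%N -> (forall i, ~~ (s <= i < s + m)%N -> f i = 0) ->
  \sum_(i < n) f i = \sum_(i < m) f (s + i)%N.
Proof.
move=> smn f0; rewrite -(big_mkord xpredT f) -(big_mkord xpredT (fun i => f (s + i)%N)).
have sn : (s <= n)%N by lia.
rewrite (@big_cat_nat _ _ _ s) //= (@big_cat_nat _ _ _ (s + m) s) //=; last by lia.
rewrite [X in X + _]big_nat_cond big1 ?add0r; last by move=> i ?; apply: f0; lia.
rewrite [X in _ + X]big_nat_cond [X in _ + X]big1 ?addr0; last by move=> i ?; apply: f0; lia.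
rewrite -{1}[s]add0n big_addn addKn.
by apply: eq_bigr => i _; rewrite addnC.
Qed.

(** * Cauchy products of formal series, and the recursive sum written with them *)

Section Series.
Variable K : comNzRingType.
Implicit Types F G H : fps3 K.

Lemma fmul_rev F G al be ga :
  fmul F G al be ga = \sum_(i < al.+1) \sum_(j < be.+1) \sum_(k < ga.+1)
    F (al - i)%N (be - j)%N (ga - k)%N * G i j k.
Proof.
rewrite /fmul (reindex_inj rev_ord_inj) /=; apply: eq_bigr => i _.
rewrite (reindex_inj rev_ord_inj) /=; apply: eq_bigr => j _.
rewrite (reindex_inj rev_ord_inj) /=; apply: eq_bigr => k _.
by rewrite !subSS !subKn // -ltnS.
Qed.

Lemma fmulC F G : fmul F G = fmul G F.
Proof.
apply/funext => al; apply/funext => be; apply/funext => ga; rewrite fmul_rev.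
by do 3 (apply: eq_bigr => ? _); rewrite mulrC.
Qed.

Lemma fmulDr F G H : fmul F (fadd G H) = fadd (fmul F G) (fmul F H).
Proof.
apply/funext => al; apply/funext => be; apply/funext => ga.
rewrite /fadd /fmul; do 3 (rewrite -big_split /=; apply: eq_bigr => ? _).
by rewrite mulrDr.
Qed.

Lemma fmulZr F (x : K) G : fmul F (fscale x G) = fscale x (fmul F G).
Proof.
apply/funext => al; apply/funext => be; apply/funext => ga.
rewrite /fscale /fmul; do 3 (rewrite big_distrr /=; apply: eq_bigr => ? _).
by rewrite mulrCA.
Qed.

Lemma fmul_mon F i j k al be ga :
  fmul F (fmon K i j k) al be ga =
  if [&& i <= al, j <= be & k <= ga]%N
  then F (al - i)%N (be - j)%N (ga - k)%N else 0.
Proof.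
rewrite fmul_rev; case: ifP => [/and3P[ile jle kle]|out].
  rewrite (bigD1 (Ordinal (ile : (i < al.+1)%N))) //= [X in _ + X]big1 ?addr0; last first.
    move=> x xi; apply: big1 => y _; apply: big1 => t _.
    by rewrite /fmon -(inj_eq val_inj) /= in xi *; rewrite (negPf xi) mulr0.
  rewrite (bigD1 (Ordinal (jle : (j < be.+1)%N))) //= [X in _ + X]big1 ?addr0; last first.
    move=> x xi; apply: big1 => t _.
    by rewrite /fmon -(inj_eq val_inj) /= in xi *; rewrite (negPf xi) andbF mulr0.
  rewrite (bigD1 (Ordinal (kle : (k < ga.+1)%N))) //= [X in _ + X]big1 ?addr0; last first.
    move=> x xi.
    by rewrite /fmon -(inj_eq val_inj) /= in xi *; rewrite (negPf xi) andbF mulr0.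
  by rewrite /fmon !eqxx mulr1.
apply: big1 => x _; apply: big1 => y _; apply: big1 => t _.
rewrite /fmon; case: andP => [[/andP[/eqP xi /eqP yj] /eqP tk]|]; last by rewrite mulr0.
by have := ltn_ord x; have := ltn_ord y; have := ltn_ord t; lia.
Qed.

(** The Euler operators in [w], [z] and [u] (this lemma and the next two) are diagonal on monomials;
    they produce the eigenvalue of the linear part. *)
Lemma fmul_dw_fw F al be ga : fmul (dw F) (@fw K) al be ga = al%:R * F al be ga.
Proof.
by rewrite fmul_mon !subn0 /dw; case: al => [|al] /=; rewrite ?mul0r // subn1.
Qed.

Lemma fmul_dz_fz F al be ga : fmul (dz F) (@fz K) al be ga = be%:R * F al be ga.
Proof.
by rewrite fmul_mon !subn0 /dz; case: be => [|be] /=; rewrite ?mul0r // subn1.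
Qed.

Lemma fmul_du_fu F al be ga : fmul (du F) (@fu K) al be ga = ga%:R * F al be ga.
Proof.
by rewrite fmul_mon !subn0 /du; case: ga => [|ga] /=; rewrite ?mul0r // subn1.
Qed.

(** The lower bound on k + j + l is handed on because it makes the recursion descend in degree. *)
Lemma eq_sum3 N (f g : int -> int -> int -> K) :
  (forall k j l : int, 3 <= k + j + l -> f k j l = g k j l) ->
  sum3 N f = sum3 N g.
Proof.
move=> fg; rewrite /sum3; apply: eq_bigr => k _; apply: eq_bigr => j _.
by apply: eq_bigr => p /andP[? _]; exact: fg.
Qed.

Lemma sum3B N (f g : int -> int -> int -> K) :
  sum3 N (fun k j l => f k j l - g k j l) = sum3 N f - sum3 N g.
Proof. by rewrite /sum3 -sumrB; do 2 (apply: eq_bigr => ? _; rewrite -sumrB). Qed.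

(* The offsets s, t, r are those of the exponents k, j, l + 1 in the three
   families b_{k,j-1,l}, a_{j,k-1,l}, d_{j-1,k-1,l+1}; s + t + r = 2 turns the
   constraint 3 <= k + j + l into the condition "total degree at least 2". *)
Lemma sum3_fmul (s t r al be ga : nat) (f : int -> int -> int -> K) F G :
  (s + t + r = 2)%N ->
  (forall k j p : nat,
     ~~ [&& s <= k <= s + al, t <= j <= t + be & r <= p <= r + ga]%N ->
     f k%:Z j%:Z (p%:Z - 1) = 0) ->
  (forall i j k : nat, (i <= al)%N -> (j <= be)%N -> (k <= ga)%N ->
     f (s + i)%N%:Z (t + j)%N%:Z ((r + k)%N%:Z - 1) =
     F (al - i)%N (be - j)%N (ga - k)%N * G i j k) ->
  sum3 (al + be + ga + 2)%N f = fmul F (ftail2 G) al be ga.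
Proof.
move=> str f0 fE; rewrite fmul_rev /sum3.
set N := (_ + 2)%N.
(* With the range condition moved into the summand, the three sums can be cut to their windows one
   after the other. *)
pose h k j p := if 3 <= k%:Z + j%:Z + (p%:Z - 1) <= N%:Z
                then f k%:Z j%:Z (p%:Z - 1) else 0.
have h0 k j p :
    ~~ [&& s <= k <= s + al, t <= j <= t + be & r <= p <= r + ga]%N -> h k j p = 0.
  by move=> out; rewrite /h f0 ?if_same.
transitivity (\sum_(k < N.+2) \sum_(j < N.+2) \sum_(p < N.+2) h k j p).
  by do 2 (apply: eq_bigr => ? _); rewrite big_mkcond.
rewrite (@sum_ord_shift _ _ s al.+1 (fun k => \sum_(j < N.+2) \sum_(p < N.+2) h k j p));
  [|by rewrite /N; lia|]; last first.
  by move=> i out; do 2 (apply: big1 => ? _); apply: h0; lia.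
apply: eq_bigr => i _.
rewrite (@sum_ord_shift _ _ t be.+1 (fun j => \sum_(p < N.+2) h (s + i)%N j p));
  [|by rewrite /N; lia|]; last first.
  by move=> j out; apply: big1 => ? _; apply: h0; lia.
apply: eq_bigr => j _.
rewrite (@sum_ord_shift _ _ r ga.+1 (fun p => h (s + i)%N (t + j)%N p));
  [|by rewrite /N; lia|]; last first.
  by move=> k out; apply: h0; lia.
apply: eq_bigr => k _.
have := ltn_ord i; have := ltn_ord j; have := ltn_ord k => kle jle ile.
rewrite /h /ftail2 fE //.
have -> : (3 <= (s + i)%N%:Z + (t + j)%N%:Z + ((r + k)%N%:Z - 1) <= N%:Z) =
          (2 <= i + j + k)%N by rewrite /N; lia.
by case: ifP => // _; rewrite mulr0.
Qed.

Section Ext.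
Implicit Types f : nat -> nat -> nat -> K.

(** The indices enter through equations, so that integer subtractions are matched to natural ones by
    linear arithmetic. *)
Lemma ext_nat f (x y t : int) (i j k : nat) :
  x = i%:Z -> y = j%:Z -> t = k%:Z -> ext f x y t = f i j k.
Proof. by move=> -> -> ->. Qed.

Lemma ext_neg f (x y t : int) : [|| x < 0, y < 0 | t < 0] -> ext f x y t = 0.
Proof. by case: x => ?; case: y => ?; case: t => ?. Qed.

Lemma ext0 (x y t : int) : ext (fun _ _ _ => 0 : K) x y t = 0.
Proof. by case: x => ?; case: y => ?; case: t. Qed.

End Ext.

Variables a b c : nat -> nat -> nat -> K.
Implicit Types e : nat -> nat -> nat -> K.

Definition source e (al be ga : nat) : K :=
  sum3 (al + be + ga + 2)%N (fun k j l : int =>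
    ((al%:Z - k + 1)%:~R * ext b k (j - 1) l
     - (be%:Z - j + 1)%:~R * ext a j (k - 1) l
     - (ga%:Z - l)%:~R * ext c (j - 1) (k - 1) (l + 1))
    * ext e (al%:Z - k + 1) (be%:Z - j + 1) (ga%:Z - l)).

(** The index of [e] has total degree al + be + ga + 2 - (k + j + l), and k + j + l >= 3; terms with
    a negative index are 0 on both sides. *)
Lemma source_local e e' al be ga :
  (forall x y t, (x + y + t < al + be + ga)%N -> e x y t = e' x y t) ->
  source e al be ga = source e' al be ga.
Proof.
move=> ee'; apply: eq_sum3 => k j l kjl; congr (_ * _).
case Ex: (_ - k + 1) => [x|//]; case Ey: (_ - j + 1) => [y|//].
by case Et: (_ - l) => [t|//] /=; apply: ee'; lia.
Qed.

(** The factor al - k + 1 times its coefficient of [e] is a coefficient of [dw e] with [w]-exponent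
    al - k; likewise for [dz] and [du]. Hence the recursive sum is minus the nonlinear part of
    dg/dT. *)
Lemma source_fmul e al be ga :
  source e al be ga =
    fmul (dw e) (ftail2 b) al be ga
    - fmul (dz e) (ftail2 (fun x y t => a y x t)) al be ga
    - fmul (du e) (ftail2 (fun x y t => c y x t)) al be ga.
Proof.
rewrite /source; set N := (_ + 2)%N.
pose E k j l := ext e (al%:Z - k + 1) (be%:Z - j + 1) (ga%:Z - l).
rewrite (@eq_sum3 N _ (fun k j l =>
      (al%:Z - k + 1)%:~R * ext b k (j - 1) l * E k j l
      - (be%:Z - j + 1)%:~R * ext a j (k - 1) l * E k j l
      - (ga%:Z - l)%:~R * ext c (j - 1) (k - 1) (l + 1) * E k j l)); last first.
  by move=> k j l _; rewrite !mulrBl.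
rewrite !sum3B; congr (_ - _ - _).
- apply: (@sum3_fmul 0 1 1) => // [k j p out|i j k ile jle kle].
    (* At k = al + 1 the [w]-index of [e] is 0, not negative, and the term dies by its factor al - k
       + 1. The same happens at j = be + 1 and p = ga + 1 in the other two families. *)
    have [->|kal] := eqVneq k (al + 1)%N; first by rewrite PoszD opprD addrA subrr sub0r addNr !mul0r.
    have [bneg|bpos] := boolP [|| (k%:Z < 0), (j%:Z - 1 < 0) | (p%:Z - 1 < 0)].
      by rewrite [ext b _ _ _]ext_neg // mulr0 mul0r.
    by rewrite /E [ext e _ _ _]ext_neg ?mulr0 //; lia.
  rewrite /E /dw (@ext_nat b _ _ _ i j k) ?(@ext_nat e _ _ _ (al - i).+1 (be - j) (ga - k)); try lia.
  by rewrite (_ : _ - _ + 1 = (al - i).+1%:Z) -?pmulrn; [ring|lia].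
- apply: (@sum3_fmul 1 0 1) => // [k j p out|i j k ile jle kle].
    have [->|jbe] := eqVneq j (be + 1)%N; first by rewrite PoszD opprD addrA subrr sub0r addNr !mul0r.
    have [bneg|bpos] := boolP [|| (j%:Z < 0), (k%:Z - 1 < 0) | (p%:Z - 1 < 0)].
      by rewrite [ext a _ _ _]ext_neg // mulr0 mul0r.
    by rewrite /E [ext e _ _ _]ext_neg ?mulr0 //; lia.
  rewrite /E /dz (@ext_nat a _ _ _ j i k) ?(@ext_nat e _ _ _ (al - i) (be - j).+1 (ga - k)); try lia.
  by rewrite (_ : _ - _ + 1 = (be - j).+1%:Z) -?pmulrn; [ring|lia].
- apply: (@sum3_fmul 1 1 0) => // [k j p out|i j k ile jle kle].
    have [->|pga] := eqVneq p (ga + 1)%N; first by rewrite PoszD addrK subrr !mul0r.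
    have [bneg|bpos] := boolP [|| (j%:Z - 1 < 0), (k%:Z - 1 < 0) | (p%:Z - 1 + 1 < 0)].
      by rewrite [ext c _ _ _]ext_neg // mulr0 mul0r.
    by rewrite /E [ext e _ _ _]ext_neg ?mulr0 //; lia.
  rewrite /E /du (@ext_nat c _ _ _ j i k) ?(@ext_nat e _ _ _ (al - i) (be - j) (ga - k).+1); try lia.
  by rewrite (_ : ga%:Z - _ = (ga - k).+1%:Z) -?pmulrn; [ring|lia].
Qed.

End Series.

(** * Fixed points of operators that look only at lower degrees *)

Section DegreeRecursion.
Variables (K : Type) (T : (nat -> nat -> nat -> K) -> nat -> nat -> nat -> K).
Hypothesis T_local : forall e e' al be ga,
  (forall x y t, (x + y + t < al + be + ga)%N -> e x y t = e' x y t) ->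
  T e al be ga = T e' al be ga.

(** Iterates of [T] stabilize degree by degree: from the n-th on, all coefficients of degree below n
    are final, whatever [e0] is. *)
Lemma degree_fixpoint (e0 : nat -> nat -> nat -> K) :
  exists e, forall al be ga, e al be ga = T e al be ga.
Proof.
pose E n := iter n T e0.
have Est n m al be ga : (al + be + ga < n)%N -> (al + be + ga < m)%N ->
    E n al be ga = E m al be ga.
  elim: n m al be ga => [//|n IH] [//|m] al be ga nlt mlt.
  by rewrite /E !iterS; apply: T_local => x y t lt; apply: IH; lia.
(* A coefficient of degree n is read off at iterate n + 1, where it is final. *)
exists (fun al be ga => E (al + be + ga).+1 al be ga) => al be ga.
rewrite /E iterS; apply: T_local => x y t lt.
by apply: (Est (al + be + ga)%N (x + y + t).+1); lia.
Qed.

Lemma degree_fixpoint_uniq e e' :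
  (forall al be ga, e al be ga = T e al be ga) ->
  (forall al be ga, e' al be ga = T e' al be ga) ->
  forall al be ga, e al be ga = e' al be ga.
Proof.
move=> fe fe' al be ga; have [n] := ubnP (al + be + ga).
elim: n al be ga => // n IH al be ga nlt; rewrite fe fe'.
by apply: T_local => x y t lt; apply: IH; lia.
Qed.

End DegreeRecursion.

(** * The differential equation as a fixed-point equation *)

Section System.
Variables (R : realType) (d : R) (a b c : nat -> nat -> nat -> R[i]).
Implicit Types (e : nat -> nat -> nat -> R[i]) (q : nat -> R[i]).

Definition lam (al be ga : nat) : R[i] :=
  1 + be%:R - al%:R + Complex 0 1 * Complex d 0 * ga%:R.

Definition resonant (al be ga : nat) := (al == be.+1) && (ga == 0)%N.

Lemma lam_resonant al be ga : resonant al be ga -> lam al be ga = 0.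
Proof.
by case/andP=> /eqP-> /eqP->; rewrite /lam mulr0 addr0 -[be.+1]add1n natrD subrr.
Qed.

(** As [d] is real, [lam] has real part 1 + be - al and imaginary part d ga, so the two conditions
    of resonance separate. *)
Lemma lam_neq0 al be ga : d != 0 -> ~~ resonant al be ga -> lam al be ga != 0.
Proof.
move=> d0 nres; apply/eqP => lam0.
have natC n : n%:R = Complex n%:R 0 :> R[i] by rewrite -(rmorph_nat (@real_complex R)).
have : lam al be ga = Complex (1 + be%:R - al%:R) (d * ga%:R).
  rewrite /lam !natC (natC 1%N : 1 = _); simpc.
  by congr Complex; ring.
rewrite lam0 => -[re0 /esym/eqP].
rewrite mulf_eq0 (negPf d0) pnatr_eq0 /= => ga0.
move: nres; rewrite /resonant ga0 andbT => /eqP; apply.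
by apply/eqP; rewrite -(eqr_nat R) -[be.+1]add1n natrD eq_sym -subr_eq0 -re0.
Qed.

(** The normalization prescribes in degrees 0 and 1 exactly the coefficients of [w], which [gser]
    puts there. *)
Lemma gser_normalized e : normalized e -> gser e = e.
Proof.
case=> e0 e1 eu ez _; apply/funext => al; apply/funext => be; apply/funext => ga.
rewrite /gser /fadd /ftail2 /fw /fmon.
case: ifP => deg; first by rewrite (_ : _ && _ = false) ?add0r //; lia.
by case: al be ga deg => [|[|al]] [|[|be]] [|[|ga]] //=; rewrite ?e0 ?e1 ?eu ?ez addr0.
Qed.

Lemma solvesP e q : normalized e ->
  solves d a b c e q <->
  forall al be ga, lam al be ga * e al be ga =
    source a b c e al be ga
    - (if resonant al be ga && (0 < be)%N then q be else 0).
Proof.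
move=> ne; rewrite /solves gser_normalized //.
have lhs al be ga : fadd (ddT d a b c e) e al be ga =
    lam al be ga * e al be ga - source a b c e al be ga.
  rewrite source_fmul /ddT /Zs /Ws /Us !fmulDr fmulZr /fadd /fopp /fscale.
  by rewrite fmul_dz_fz fmul_dw_fw fmul_du_fu /lam; ring.
(* Multiplication by [w] moves the diagonal index (m, m, 0) to (m + 1, m, 0); 0 < be reflects that
   the series starts at m = 1. *)
have rhs al be ga : fopp (fmul (@fw R[i]) (fdiag q)) al be ga =
    - (if resonant al be ga && (0 < be)%N then q be else 0).
  rewrite /fopp fmulC fmul_mon !subn0 /= andbT /fdiag /resonant; congr (- _).
  case: al => [//|al] /=; rewrite subn1 /= eqSS.
  by case: eqVneq => [->|_]; rewrite ?andbF // andbC.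
split=> H al be ga; move: (H al be ga); rewrite lhs rhs => /eqP.
  by rewrite subr_eq addrC => /eqP.
by move=> /eqP ->; rewrite addrAC subrr add0r.
Qed.

(** The degree test comes first because (1, 0, 0) is resonant, yet its coefficient must be 1 and not
    0. *)
Definition step e (al be ga : nat) : R[i] :=
  if (al + be + ga < 2)%N then fmon R[i] 1 0 0 al be ga
  else if resonant al be ga then 0
  else (lam al be ga)^-1 * source a b c e al be ga.

Lemma step_local e e' al be ga :
  (forall x y t, (x + y + t < al + be + ga)%N -> e x y t = e' x y t) ->
  step e al be ga = step e' al be ga.
Proof. by move=> ee'; rewrite /step (source_local a b c ee'). Qed.

Lemma step_fixpoint_normalized e :
  (forall al be ga, e al be ga = step e al be ga) -> normalized e.
Proof.
move=> fe; split; rewrite ?fe // => -[//|k] _.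
by rewrite fe /step /resonant !eqxx.
Qed.

(** Only coefficients of degree 0 could enter, and the constant term is 0. *)
Lemma source_low e al be ga : (al + be + ga < 2)%N ->
  normalized e -> source a b c e al be ga = 0.
Proof.
move=> deg [e0 _ _ _ _].
rewrite (@source_local _ a b c e (fun _ _ _ => 0)); last first.
  by move=> [|x] [|y] [|t] lt; rewrite ?e0 //; lia.
rewrite /source (@eq_sum3 _ _ _ (fun _ _ _ => 0)); first by rewrite /sum3; do 3 (apply: big1 => ? _).
by move=> k j l _; rewrite ext0 mulr0.
Qed.

Lemma step_fixpoint_solves e : d != 0 ->
  (forall al be ga, e al be ga = step e al be ga) ->
  solves d a b c e (fun m => source a b c e m.+1 m 0).
Proof.
move=> d0 fe; have ne := step_fixpoint_normalized fe; apply/solvesP => // al be ga.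
have [res|nres] := boolP (resonant al be ga).
  rewrite lam_resonant // mul0r; case/andP: res => /eqP-> /eqP->.
  (* At (1, 0, 0) no q is available to absorb the source, which must vanish by itself. *)
  by case: be => [|be] /=; rewrite ?subrr // source_low ?subr0.
rewrite subr0 fe /step (negPf nres); case: ifP => deg.
  (* In degree below 2 the only nonzero coefficient sits at the resonant (1, 0, 0), excluded
     here. *)
  rewrite source_low //; move: deg nres.
  by case: al be ga => [|[|al]] [|[|be]] [|[|ga]] //=; rewrite mulr0.
by rewrite mulVKf // lam_neq0.
Qed.

Lemma solves_step_fixpoint e q : d != 0 -> normalized e -> solves d a b c e q ->
  (forall al be ga, e al be ga = step e al be ga) /\
  (forall m, (0 < m)%N -> q m = source a b c e m.+1 m 0).
Proof.
move=> d0 ne /(solvesP _ ne) se; split=> [al be ga|m m0]; last first.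
  move/eqP: (se m.+1 m 0%N); rewrite lam_resonant /resonant ?eqxx //= m0 mul0r.
  by rewrite eq_sym subr_eq0 => /eqP.
rewrite /step; case: ifP => deg.
  case: ne => e0 e1 eu ez _.
  by case: al be ga deg => [|[|al]] [|[|be]] [|[|ga]] //=; rewrite ?e0 ?e1 ?eu ?ez.
case: ifP => [/andP[/eqP alE /eqP gaE]|/negbT nres].
  (* Total degree at least 2 forces be > 0, as the normalization requires. *)
  by case: ne => _ _ _ _ res0; rewrite alE gaE res0 //; lia.
have := se al be ga; rewrite (negPf nres) subr0 => <-.
by rewrite mulKf // lam_neq0.
Qed.

End System.

Theorem theorem3p2 (R : realType) (d : R) (d_neq0 : d != 0)
    (a b c : nat -> nat -> nat -> R[i]) :
  exists (e : nat -> nat -> nat -> R[i]) (q : nat -> R[i]),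
    [/\ normalized e,
        solves d a b c e q,
        (forall (e' : nat -> nat -> nat -> R[i]) (q' : nat -> R[i]),
           normalized e' -> solves d a b c e' q' ->
           (forall al be ga : nat, e' al be ga = e al be ga) /\
           (forall m : nat, (0 < m)%N -> q' m = q m)),
        (forall al be ga : nat, (2 <= al + be + ga)%N ->
           al <> be.+1 \/ (al = be.+1 /\ ga <> 0%N) ->
           e al be ga =
           (1 + be%:R - al%:R + Complex 0 1 * Complex d 0 * ga%:R)^-1 *
           sum3 (al + be + ga + 2)%N (fun k j l : int =>
             ((al%:Z - k + 1)%:~R * ext b k (j - 1) l
              - (be%:Z - j + 1)%:~R * ext a j (k - 1) l
              - (ga%:Z - l)%:~R * ext c (j - 1) (k - 1) (l + 1))
             * ext e (al%:Z - k + 1) (be%:Z - j + 1) (ga%:Z - l)))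
      & (forall m : nat, (0 < m)%N ->
           q m =
           sum3 (2 * m + 3)%N (fun k j l : int =>
             ((m%:Z - k + 2)%:~R * ext b k (j - 1) l
              - (m%:Z - j + 1)%:~R * ext a j (k - 1) l
              + l%:~R * ext c (j - 1) (k - 1) (l + 1))
             * ext e (m%:Z - k + 2) (m%:Z - j + 1) (- l)))].
Proof.
have [e fe] := degree_fixpoint (@step_local R d a b c) (fun _ _ _ => 0).
exists e, (fun m => source a b c e m.+1 m 0); split.
- exact: step_fixpoint_normalized fe.
- exact: step_fixpoint_solves.
- move=> e' q' ne' se'; have [fe' q'E] := solves_step_fixpoint d_neq0 ne' se'.
  have ee' := degree_fixpoint_uniq (@step_local R d a b c) fe' fe.
  by split=> // m m0; rewrite q'E //; apply: source_local => x y t _.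
- move=> al be ga deg nres.
  have /negPf nonres : ~~ resonant al be ga.
    by apply/negP => /andP[/eqP alE /eqP gaE]; case: nres => [|[]].
  by rewrite {1}fe /step ltnNge deg nonres.
(* The source at (m + 1, m, 0) has upper bound 2m + 3. *)
- move=> m m0; have -> : (2 * m + 3 = m.+1 + m + 0 + 2)%N by lia.
  apply: eq_sum3 => k j l _.
  have -> : m.+1%:Z - k + 1 = m%:Z - k + 2 by lia.
  (* Here ga = 0, so -(ga - l) becomes +l. *)
  by rewrite sub0r mulrNz mulNr opprK.
Qed.
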